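(* Let $(\mathcal S,\mathcal A,J,P,c)$ be an SSP instance with $c\ge0$ such that in the support graph there is a directed path from every state vertex to the target state vertex. Then the primal-dual algorithm described below can be initialized with $\bar y=0$, and if its MAXPROB subproblems (RP) are solved using Howard's policy iteration (or any other simple policy iteration method), it terminates in a finite number of steps.
   Context: An SSP instance is a tuple $(\mathcal S,\mathcal A,J,P,c)$ with states $\mathcal S=\{0,\dots,n\}$ (target $0$), actions $\mathcal A=\{0,\dots,m\}$ (action $0$ unique at state $0$, leading to $0$ with probability 1), $J\in\{0,1\}^{m\times n}$ with $J(a,s)=1$ iff action $a$ is available in state $s$ (each action $a\ge1$ available in exactly one state; $\mathcal A(s)$ the actions available in $s$), $P$ an $m\times n$ row-substochastic matrix with $P(a,s)=p(s|a)$ the probability of moving to $s\in\{1,\dots,n\}$ after action $a$ and $p(0|a)=1-\sum_sP(a,s)$, and $c\in\mathbb R^m$. The support graph is the directed bipartite graph on state vertices and action vertices with arcs $(s,a)$ for $s\ge1,a\in\mathcal A(s)$, arcs $(a,s)$ whenever $a\ge1$ and $p(s|a)>0$, and arcs between target state and target action in both directions. Consider the linear programs (P) $\min\{c^Tx:(J-P)^Tx=\mathbf 1,x\ge0\}$ and its dual (D) $\max\{\mathbf 1^Ty:(J-P)y\le c\}$. Primal-dual algorithm: start with a feasible $\bar y$ for (D). At each iteration let $\bar{\mathcal A}:=\{a\in\{1,\dots,m\}:((J-P)\bar y)_a=c_a\}$ and let $J_{\bar{\mathcal A}},P_{\bar{\mathcal A}}$ be the restrictions of $J,P$ to the rows in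 $\bar{\mathcal A}$. Solve the restricted primal (RP) $\min\{\mathbf 1^Tz:(J_{\bar{\mathcal A}}-P_{\bar{\mathcal A}})^Tx_{\bar{\mathcal A}}+z=\mathbf 1,\ x_{\bar{\mathcal A}},z\ge0\}$ and its dual (DRP) $\max\{\mathbf 1^Ty:(J_{\bar{\mathcal A}}-P_{\bar{\mathcal A}})y\le0,\ y\le\mathbf 1\}$. If (RP) has optimal value $0$, stop (its $x$-part, extended by zeros, is optimal for (P)). Otherwise take an optimal solution $\underline y$ of (DRP), replace $\bar y$ by $\bar y+\epsilon\underline y$ with $\epsilon\ge0$ maximal such that it stays feasible for (D), and iterate. The problem (RP) (called MAXPROB) is itself an SSP instance with action set $\bar{\mathcal A}\cup\{m+1,\dots,m+n\}$, where actions in $\bar{\mathcal A}$ have cost $0$ and action $m+k$ ($k=1,\dots,n$) is available in state $k$, has cost $1$ and leads to state $0$ with probability one; it is solved by policy iteration. Howard's policy iteration on an SSP: starting from a proper deterministic stationary policy $\Pi$ (one action $\Pi(i)\in\mathcal A(i)$ per state, with finite expected number of steps from every state), compute the reduced costs $\bar c^\Pi:=c-c_\Pi(I-P_\Pi)^{-T}(J-P)^T$ (with $P_\Pi$ the $n\times n$ matrix whose $i$-th row is row $\Pi(i)$ of $P$, $c_\Pi=(c(\Pi(i)))_i$); if all are nonnegative stop, otherwise in each state having an action of negative reduced cost switch to such an action, and iterate. A simple policy iteration method is a simplex method on the corresponding linear program starting from the basis of a proper deterministic stationary policy, changing one action per iteration. *)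

(* Defs.v *)
From HB Require Import structures.
From mathcomp Require Import all_boot all_order all_algebra.
From mathcomp Require Import all_classical all_reals all_analysis.

Set Implicit Arguments.
Unset Strict Implicit.
Unset Printing Implicit Defensive.

Import Order.TTheory GRing.Theory Num.Theory.
Local Open Scope ring_scope.

(* The non-target states 1..n are 'I_n and the non-target actions 1..m are
   'I_m. The target state 0 and the target action 0, which carry no data, only
   show up in the support graph, as None. *)
Record ssp (R : realType) (n m : nat) := SSP {
  sspJ : 'M[R]_(m, n);
  sspP : 'M[R]_(m, n);
  sspc : 'cV[R]_m }.

Section Instance.
Variables (R : realType) (n m : nat) (I : ssp R n m).

Definition is_ssp : Prop :=
  [/\ forall a s, sspJ I a s = 0 \/ sspJ I a s = 1,
      forall a, exists! s, sspJ I a s = 1,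
      forall a s, 0 <= sspP I a s
    & forall a, \sum_s sspP I a s <= 1].

Definition avail (s : 'I_n) (a : 'I_m) : bool := sspJ I a s == 1.

Definition trans_prob (a : 'I_m) (t : option 'I_n) : R :=
  if t is Some s then sspP I a s else 1 - \sum_s sspP I a s.

(* inl = state vertices, inr = action vertices *)
Definition support_arc (u v : option 'I_n + option 'I_m) : bool :=
  match u, v with
  | inl (Some s), inr (Some a) => avail s a
  | inr (Some a), inl t => 0 < trans_prob a t
  | inl None, inr None => true
  | inr None, inl None => true
  | _, _ => false
  end.

Definition target_reachable : Prop :=
  forall t : option 'I_n, connect support_arc (inl t) (inl None).

Definition policy_P (Pi : {ffun 'I_n -> 'I_m}) : 'M[R]_n :=
  rowsub Pi (sspP I).

Definition policy_c (Pi : {ffun 'I_n -> 'I_m}) : 'cV[R]_n :=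
  rowsub Pi (sspc I).

(* E[T] = \sum_k Pr(T > k), where T is the hitting time of the target from i;
   the probability of not having reached the target after k steps is the i-th
   entry of policy_P Pi ^+ k times the all-ones vector. *)
Definition expected_steps (Pi : {ffun 'I_n -> 'I_m}) (i : 'I_n) : \bar R :=
  (\sum_(0 <= k <oo) ((policy_P Pi ^+ k *m (const_mx 1 : 'cV[R]_n)) i 0)%:E)%E.

Definition proper_policy (Pi : {ffun 'I_n -> 'I_m}) : Prop :=
  (forall i, avail i (Pi i)) /\
  (forall i, (expected_steps Pi i < +oo)%E).

Definition reduced_cost (Pi : {ffun 'I_n -> 'I_m}) : 'rV[R]_m :=
  (sspc I)^T - (policy_c Pi)^T *m (invmx (1%:M - policy_P Pi))^T
               *m (sspJ I - sspP I)^T.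

Definition pi_optimal (Pi : {ffun 'I_n -> 'I_m}) : Prop :=
  forall a, 0 <= reduced_cost Pi 0 a.

Definition improving (Pi : {ffun 'I_n -> 'I_m}) (i : 'I_n) (a : 'I_m) : bool :=
  avail i a && (reduced_cost Pi 0 a < 0).

(* One iteration of Howard's method; which improving action is taken in a
   state is left open. *)
Definition howard_switch (Pi Pi' : {ffun 'I_n -> 'I_m}) : Prop :=
  forall i, if [exists a, improving Pi i a] then improving Pi i (Pi' i) : Prop
            else Pi' i = Pi i.

(* From here to exchange: the simplex method on
   min { c^T x | (J - P)^T x = 1, x >= 0 }. A basis is given as the list
   'I_n -> 'I_m of its columns, so that a policy can be read as a basis. *)
Definition basis_mx (B : {ffun 'I_n -> 'I_m}) : 'M[R]_n :=
  (rowsub B (sspJ I - sspP I))^T.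

Definition basic_val (B : {ffun 'I_n -> 'I_m}) : 'cV[R]_n :=
  invmx (basis_mx B) *m const_mx 1.

Definition basic_sol (B : {ffun 'I_n -> 'I_m}) : 'cV[R]_m :=
  \col_a \sum_(i | B i == a) basic_val B i 0.

Definition pivot_col (B : {ffun 'I_n -> 'I_m}) (q : 'I_m) : 'cV[R]_n :=
  invmx (basis_mx B) *m (row q (sspJ I - sspP I))^T.

(* Minimum ratio test: the basic variable in position r may leave when q
   enters. That r is the state where q is available is not imposed. *)
Definition leaving (B : {ffun 'I_n -> 'I_m}) (q : 'I_m) (r : 'I_n) : Prop :=
  0 < pivot_col B q r 0 /\
  forall i, 0 < pivot_col B q i 0 ->
    basic_val B r 0 / pivot_col B q r 0 <= basic_val B i 0 / pivot_col B q i 0.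

Definition exchange (B : {ffun 'I_n -> 'I_m}) (q : 'I_m) (r : 'I_n) :
    {ffun 'I_n -> 'I_m} :=
  [ffun i => if i == r then q else B i].

Definition D_feasible (y : 'cV[R]_n) : Prop :=
  forall a, ((sspJ I - sspP I) *m y) a 0 <= sspc I a 0.

Definition tight (y : 'cV[R]_n) : {set 'I_m} :=
  [set a | ((sspJ I - sspP I) *m y) a 0 == sspc I a 0].

Definition restrict_rows (A : {set 'I_m}) (p : nat) (M : 'M[R]_(m, p)) :
    'M[R]_(#|A|, p) :=
  rowsub (fun k : 'I_#|A| => enum_val k) M.

Definition JP_restr (y : 'cV[R]_n) : 'M[R]_(#|tight y|, n) :=
  restrict_rows (tight y) (sspJ I) - restrict_rows (tight y) (sspP I).

Definition RP_feasible (y : 'cV[R]_n) (x : 'cV[R]_#|tight y|) (z : 'cV[R]_n) :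
    Prop :=
  [/\ (JP_restr y)^T *m x + z = const_mx 1,
      forall a, 0 <= x a 0
    & forall i, 0 <= z i 0].

Definition RP_optimal (y : 'cV[R]_n) (x : 'cV[R]_#|tight y|) (z : 'cV[R]_n) :
    Prop :=
  RP_feasible x z /\
  forall (x' : 'cV[R]_#|tight y|) (z' : 'cV[R]_n), RP_feasible x' z' ->
    \sum_i z i 0 <= \sum_i z' i 0.

Definition DRP_feasible (y d : 'cV[R]_n) : Prop :=
  (forall a, (JP_restr y *m d) a 0 <= 0) /\ (forall i, d i 0 <= 1).

Definition DRP_optimal (y d : 'cV[R]_n) : Prop :=
  DRP_feasible y d /\
  forall d', DRP_feasible y d' -> \sum_i d' i 0 <= \sum_i d i 0.

Definition max_step (y d : 'cV[R]_n) (e : R) : Prop :=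
  [/\ 0 <= e, D_feasible (y + e *: d)
    & forall e', 0 <= e' -> D_feasible (y + e' *: d) -> e' <= e].

(* (RP) as an SSP instance: the actions are first those of tight y, of cost 0,
   then one action per state, of cost 1, leading to the target. *)
Definition maxprob (y : 'cV[R]_n) : ssp R n (#|tight y| + n) :=
  SSP (col_mx (restrict_rows (tight y) (sspJ I)) 1%:M)
      (col_mx (restrict_rows (tight y) (sspP I)) 0)
      (col_mx 0 (const_mx 1)).

End Instance.

Inductive pi_method := Howard | Simple.

Section Algorithm.
Variables (R : realType) (n m : nat) (I : ssp R n m).

Definition mp_policy (y : 'cV[R]_n) : Type :=
  {ffun 'I_n -> 'I_(#|tight I y| + n)}.

(* Start y: an iteration begins with the dual solution y.
   Solve y Pi: Pi is the current policy for maxprob I y.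
   Pivot y Pi q: in the simplex method, q has been chosen to enter the basis.
   Update y d: d is the chosen optimal solution of (DRP). *)
Inductive config : Type :=
  | Start of 'cV[R]_n
  | Solve (y : 'cV[R]_n) of mp_policy y
  | Pivot (y : 'cV[R]_n) of mp_policy y & 'I_(#|tight I y| + n)
  | Update of 'cV[R]_n & 'cV[R]_n
  | Done.

(* The x- and z-part of the (RP) solution given by the policy Pi. *)
Definition mp_solution (y : 'cV[R]_n) (Pi : mp_policy y) :
    'cV[R]_#|tight I y| * 'cV[R]_n :=
  let x := basic_sol (maxprob I y) Pi in (usubmx x, dsubmx x).

(* All choices the algorithm leaves open (starting policy of each subproblem,
   improving actions, entering and leaving variables, optimal solution of
   (DRP)) are nondeterministic. A configuration from which the algorithm
   cannot go on -- improper current policy, no leaving variable, policy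
   iteration stopped at a non-optimal solution, no maximal step length -- has
   no successor. *)
Inductive pd_step (meth : pi_method) : config -> config -> Prop :=
  | StepStart y (Pi : mp_policy y) :
      proper_policy (maxprob I y) Pi ->
      pd_step meth (Start y) (Solve Pi)
  | StepHoward y (Pi Pi' : mp_policy y) :
      meth = Howard ->
      proper_policy (maxprob I y) Pi ->
      ~ pi_optimal (maxprob I y) Pi ->
      howard_switch (maxprob I y) Pi Pi' ->
      pd_step meth (Solve Pi) (Solve Pi')
  | StepEnter y (Pi : mp_policy y) q :
      meth = Simple ->
      proper_policy (maxprob I y) Pi ->
      reduced_cost (maxprob I y) Pi 0 q < 0 ->
      pd_step meth (Solve Pi) (Pivot Pi q)
  | StepLeave y (Pi : mp_policy y) q r :
      leaving (maxprob I y) Pi q r ->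
      pd_step meth (Pivot Pi q) (@Solve y (exchange Pi q r))
  | StepStop y (Pi : mp_policy y) x z :
      proper_policy (maxprob I y) Pi ->
      pi_optimal (maxprob I y) Pi ->
      mp_solution Pi = (x, z) ->
      RP_optimal x z ->
      \sum_i z i 0 = 0 ->
      pd_step meth (Solve Pi) Done
  | StepDirection y (Pi : mp_policy y) x z d :
      proper_policy (maxprob I y) Pi ->
      pi_optimal (maxprob I y) Pi ->
      mp_solution Pi = (x, z) ->
      RP_optimal x z ->
      \sum_i z i 0 <> 0 ->
      DRP_optimal I y d ->
      pd_step meth (Solve Pi) (Update y d)
  | StepUpdate y d e :
      max_step I y d e ->
      pd_step meth (Update y d) (Start (y + e *: d)).

(* Every run from k, whatever the choices made, is finite and can only end in
   Done. *)
Inductive pd_terminates (meth : pi_method) : config -> Prop :=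
  | TermDone : pd_terminates meth Done
  | TermStep k :
      (exists k', pd_step meth k k') ->
      (forall k', pd_step meth k k' -> pd_terminates meth k') ->
      pd_terminates meth k.

End Algorithm.

Arguments Start {R n m I} _.
Arguments Done {R n m I}.

(* Main.v *)
(* A policy is proper iff it has no trap: a nonempty set of states that it never
   leaves. By the minimum principle, in the absence of traps (1 - Q) w >= 0
   implies w >= 0, so 1 - Q is invertible with a nonnegative inverse.

   Policy iteration: as all costs are nonnegative, an improving switch creates
   no trap and strictly decreases the sum of the values, so each (RP) is solved
   after finitely many switches. A simplex pivot is a switch too, because basic
   solutions are positive: the leaving action must belong to the state of the
   entering one.

   Outer loop: every feasible point of (DRP) lies componentwise below the value
   of any proper policy, so the optimal solution d of (DRP) is unique, equal to
   the value of the final policy. The actions of that policy stay tight after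
   the update of y, and a new action a with ((J - P) d)_a > 0 becomes tight, so
   the optimal value of (DRP) strictly decreases. It depends only on the set of
   tight actions, of which there are finitely many. The step length is finite
   because, by reachability of the target, (J - P) d <= 0 forces d <= 0. *)
Require Import Defs.
From HB Require Import structures.
From mathcomp Require Import all_boot all_order all_algebra.
From mathcomp Require Import all_classical all_reals all_analysis.
From mathcomp Require Import lra.

Set Implicit Arguments.
Unset Strict Implicit.
Unset Printing Implicit Defensive.

Import Order.TTheory GRing.Theory Num.Theory.
Local Open Scope ring_scope.

(** * Induction along a decreasing real value, and auxiliary facts *)

(** Finitely many points leave no infinite descent of [f]; the induction counts the points of
    smaller value. It serves both for policies and for tight sets. *)
Lemma fin_value_ind (R : realType) (T : finType) (f : T -> R) (P : T -> Prop) :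
  (forall x, (forall y, f y < f x -> P y) -> P x) -> forall x, P x.
Proof.
move=> IH x; have [k] := ubnP #|[set z | f z < f x]|.
elim: k x => // k IHk x lek; apply: IH => y ltyx; apply: IHk.
apply: leq_trans (ltnSE lek); apply/proper_card/fintype.properP; split.
  by apply/fintype.subsetP => z; rewrite !inE => /lt_trans; apply.
by exists y; rewrite !inE ?ltxx.
Qed.

Lemma connect_invariant (T : finType) (e : rel T) (Q : T -> Prop) (u v : T) :
  (forall x y, Q x -> e x y -> Q y) -> connect e u v -> Q u -> Q v.
Proof.
move=> He /connectP[p + ->]; elim: p u => //= x p IHp u /andP[eux pp] Qu.
by apply: IHp => //; apply: He eux.
Qed.

Lemma col_le_sum_eq (R : realType) (n : nat) (v w : 'cV[R]_n) :
  (forall i, v i 0 <= w i 0) -> \sum_i w i 0 <= \sum_i v i 0 -> v = w.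
Proof.
move=> le sumle; have ge0 i : true -> 0 <= w i 0 - v i 0 by rewrite subr_ge0.
have /(psumr_eq0P ge0) H : \sum_i (w i 0 - v i 0) = 0.
  by apply/eqP; rewrite eq_le sumr_ge0 // andbT sumrB subr_le0.
by apply/matrixP => i j; rewrite ord1; apply/esym/eqP; rewrite -subr_eq0 H.
Qed.

(** * Substochastic matrices: traps, monotonicity, hitting times *)

Section Substochastic.
Variables (R : realType) (n : nat) (Q : 'M[R]_n).
Hypothesis Q_ge0 : forall i j, 0 <= Q i j.
Hypothesis Q_le1 : forall i, \sum_j Q i j <= 1.

Definition trap (C : {set 'I_n}) : Prop :=
  (exists i, i \in C) /\ (forall i, i \in C -> \sum_(j in C) Q i j = 1).

Definition transient : Prop := forall C, ~ trap C.

Lemma oneB_mulmxE (w : 'cV[R]_n) i :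
  ((1%:M - Q) *m w) i 0 = w i 0 - \sum_j Q i j * w j 0.
Proof. by rewrite mulmxBl mul1mx !mxE. Qed.

Lemma trap_outside C i j : trap C -> i \in C -> j \notin C -> Q i j = 0.
Proof.
move=> [_ HC] Ci Cj; have := Q_le1 i.
rewrite (bigID (mem C)) /= HC // -lerBrDl subrr => H.
have /psumr_eq0P : \sum_(k | k \notin C) Q i k = 0.
  by apply/eqP; rewrite eq_le H /= sumr_ge0.
by apply.
Qed.

(* Minimum principle: a superharmonic function on a closed set [C] is harmonic
   on its set of minimizers, which no transition leaves. *)
Lemma superharmonic_trap (C : {set 'I_n}) (w : 'I_n -> R) :
  (exists i, i \in C) ->
  (forall i j, i \in C -> j \notin C -> Q i j = 0) ->
  (forall i, i \in C -> \sum_j Q i j * w j <= w i) ->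
  (forall i, i \in C -> \sum_j Q i j = 1) \/ (exists2 i, i \in C & w i < 0) ->
  exists D, trap D /\ (forall i, i \in D -> \sum_j Q i j * w j = w i).
Proof.
move=> [i0 Ci0] Cout sup alt.
case: (arg_minP w Ci0) => k; rewrite -/(k \in C) => Ck kmin.
pose D := [set i in C | w i == w k].
have key i : i \in D ->
    [/\ \sum_j Q i j = 1, \sum_j Q i j * w j = w i
      & forall j, Q i j * (w j - w k) = 0].
  rewrite inE => /andP[Ci /eqP wik].
  have tge0 j : 0 <= Q i j * (w j - w k).
    have [Cj|Cj] := boolP (j \in C); last by rewrite Cout // mul0r.
    by rewrite mulr_ge0 // subr_ge0 kmin.
  have E : \sum_j Q i j * (w j - w k) =
      \sum_j Q i j * w j - (\sum_j Q i j) * w k.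
    rewrite mulr_suml -sumrB; apply: eq_bigr => j _; exact: mulrBr.
  have S0 : 0 <= \sum_j Q i j * (w j - w k) by apply: sumr_ge0.
  have := sup _ Ci; have := Q_le1 i; rewrite wik => H1 H2.
  (* In the second alternative [w k < 0], and [(\sum_j Q i j) * w k <= w k] forces the row sum up to
     1. *)
  have Hs : \sum_j Q i j = 1.
    case: alt => [->//|[l Cl wl0]]; have := kmin _ Cl => Hk.
    move: E S0 => ->; nra.
  split => //; first by move: E S0 => ->; rewrite Hs; lra.
  have /psumr_eq0P H : \sum_j Q i j * (w j - w k) = 0.
    by apply/eqP; rewrite eq_le S0 andbT E Hs; lra.
  by move=> j; apply: H.
exists D; split; last by move=> i /key[].
split; first by exists k; rewrite inE eqxx andbT.
move=> i Di; have [<- _ Hz] := key i Di.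
rewrite [RHS](bigID (mem D)) /= [X in _ + X]big1 ?addr0 // => j.
rewrite inE negb_and; have Ci : i \in C by move: Di; rewrite inE => /andP[].
move=> /orP[Cj|wj]; first exact: Cout.
by have /eqP := Hz j; rewrite mulf_eq0 subr_eq0 (negbTE wj) orbF => /eqP.
Qed.

Lemma transient_monotone (w : 'cV[R]_n) : transient ->
  (forall i, 0 <= ((1%:M - Q) *m w) i 0) -> forall i, 0 <= w i 0.
Proof.
move=> Qt Hw i; rewrite leNgt; apply/negP => wi0.
have [||||D [+ _]] := @superharmonic_trap [set: 'I_n] (fun i => w i 0).
- by exists i; rewrite inE.
- by move=> k j; rewrite !inE.
- by move=> k _; have := Hw k; rewrite oneB_mulmxE subr_ge0.
- by right; exists i; rewrite ?inE.
- exact: Qt.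
Qed.

Lemma transient_le (v w : 'cV[R]_n) : transient ->
  (forall i, ((1%:M - Q) *m v) i 0 <= ((1%:M - Q) *m w) i 0) ->
  forall i, v i 0 <= w i 0.
Proof.
move=> Qt le i; have -> : w = v + (w - v) by rewrite addrC subrK.
rewrite mxE lerDl; apply: transient_monotone => // j.
by rewrite mulmxBr mxE [X in _ + X]mxE subr_ge0.
Qed.

(** Monotonicity applies to a kernel vector and to its opposite, so the vector vanishes. *)
Lemma transient_unitmx : transient -> 1%:M - Q \in unitmx.
Proof.
move=> Qt; rewrite -unitmx_tr -row_free_unit -kermx_eq0.
apply/rowV0P => v /sub_kermxP /(congr1 trmx).
rewrite trmx_mul trmxK trmx0 => H.
have Hp := transient_monotone (w := v^T) Qt.
have Hn := transient_monotone (w := - v^T) Qt.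
apply/matrixP => i j; rewrite mxE ord1; apply/eqP; rewrite eq_le.
rewrite -oppr_ge0.
have := Hp _ j; have := Hn _ j; rewrite mulmxN H oppr0 !mxE => -> //.
  by move=> ->// => k; rewrite mxE.
by move=> k; rewrite mxE.
Qed.

Lemma transient_invmx_ge0 i j : transient -> 0 <= invmx (1%:M - Q) i j.
Proof.
move=> Qt; have := transient_monotone (w := col j (invmx (1%:M - Q))) Qt.
move=> /(_ _ i); rewrite mxE; apply => k.
by rewrite colE mulKVmx ?transient_unitmx // mxE ler0n.
Qed.

Lemma pow_one_ge0 k i : 0 <= (Q ^+ k *m (const_mx 1 : 'cV[R]_n)) i 0.
Proof.
elim: k i => [|k IHk] i; first by rewrite expr0 mul1mx mxE.
by rewrite exprS -mulmxA mxE; apply: sumr_ge0 => j _; apply: mulr_ge0.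
Qed.

Lemma trap_pow_one k i C : trap C -> i \in C ->
  1 <= (Q ^+ k *m (const_mx 1 : 'cV[R]_n)) i 0.
Proof.
move=> trC; elim: k i => [|k IHk] i Ci; first by rewrite expr0 mul1mx mxE.
rewrite exprS -mulmxA mxE -[leLHS](trC.2 _ Ci) [leRHS](bigID (mem C)) /=.
rewrite -[leLHS]addr0 lerD //; last first.
  by apply: sumr_ge0 => j _; apply: mulr_ge0 => //; exact: pow_one_ge0.
by apply: ler_sum => j Cj; rewrite ler_peMr // IHk.
Qed.

(** Translates finiteness of the expected number of steps, an analytic condition, into the absence
    of traps, which is what the later arguments use. *)
Lemma transientP : transient <->
  (forall i, (\sum_(0 <= k <oo)
     ((Q ^+ k *m (const_mx 1 : 'cV[R]_n)) i 0)%:E < +oo)%E).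
Proof.
have pos i k : (0 <= ((Q ^+ k *m (const_mx 1 : 'cV[R]_n)) i 0)%:E)%E.
  by rewrite lee_fin pow_one_ge0.
split=> [Qt i|fin C trC]; last first.
  have [i Ci] := trC.1.
  pose S j :=
    (\sum_(0 <= k <oo) ((Q ^+ k *m (const_mx 1 : 'cV[R]_n)) j 0)%:E)%E.
  (* From inside a trap every survival probability is at least 1, so the partial sums exceed every
     natural number. *)
  have SN N : (N%:R%:E <= S i)%E.
    apply: le_trans (nneseries_lim_ge N _) => //.
    rewrite sumEFin lee_fin big_mkord.
    rewrite -[N in leLHS]card_ord -sum1_card natr_sum; apply: ler_sum => k _.
    exact: trap_pow_one trC Ci.
  have Sfin : S i \is a fin_num.
    by rewrite ge0_fin_numE ?fin //; apply: nneseries_ge0.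
  have := SN (Num.truncn (fine (S i))).+1.
  rewrite -(fineK Sfin) lee_fin leNgt truncnS_gt //.
(* [v] is the candidate for the expected hitting times; the partial sums telescope to
   [v - Q ^+ N *m v], hence stay below [v]. *)
pose v : 'cV[R]_n := invmx (1%:M - Q) *m const_mx 1.
have Qv : (1%:M - Q) *m v = const_mx 1.
  by rewrite mulKVmx // transient_unitmx.
have v0 j : 0 <= v j 0.
  by apply: (transient_monotone Qt) => l; rewrite Qv mxE.
have pv0 k j : 0 <= (Q ^+ k *m v) j 0.
  elim: k j => [|k IHk] j; first by rewrite expr0 mul1mx.
  by rewrite exprS -mulmxA mxE; apply: sumr_ge0 => l _; apply: mulr_ge0.
have part N : \sum_(k < N) (Q ^+ k *m (const_mx 1 : 'cV[R]_n)) =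
    v - Q ^+ N *m v.
  elim: N => [|N IHN]; first by rewrite big_ord0 expr0 mul1mx subrr.
  rewrite big_ord_recr /= IHN -Qv mulmxBl mul1mx mulmxBr mulmxA -[_ *m Q]exprSr.
  by rewrite addrA subrK.
apply: (@le_lt_trans _ _ (v i 0)%:E); last exact: ltry.
apply: lime_le; first exact: is_cvg_nneseries.
near=> N; rewrite sumEFin lee_fin big_mkord.
have := congr1 (fun M : 'cV[R]_n => M i 0) (part N).
rewrite summxE !mxE => ->; rewrite lerBlDr lerDl.
by have := pv0 N i; rewrite mxE.
Unshelve. all: by end_near.
Qed.

End Substochastic.

(** * Policy values and improving switches *)

Definition policy_value (R : realType) (n m : nat) (K : ssp R n m)
    (Pi : {ffun 'I_n -> 'I_m}) : 'cV[R]_n :=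
  invmx (1%:M - policy_P K Pi) *m policy_c K Pi.

Section PolicyIteration.
Variables (R : realType) (n m : nat) (K : ssp R n m).
Hypothesis hK : is_ssp K.
Implicit Types Pi : {ffun 'I_n -> 'I_m}.

Lemma sspJ_avail s a t : avail K s a -> sspJ K a t = (t == s)%:R.
Proof.
case: hK => J01 Juniq _ _ /eqP Js; have [u [Ju uniq]] := Juniq a.
have [->|ts] := eqVneq t s; first exact: Js.
by case: (J01 a t) => // Jt; rewrite -(uniq _ Js) -(uniq _ Jt) eqxx in ts.
Qed.

Lemma avail_ex a : exists s, avail K s a.
Proof. by case: hK => _ /(_ a)[s [Js _]] _ _; exists s; apply/eqP. Qed.

Lemma JP_mulmxE s a (w : 'cV[R]_n) : avail K s a ->
  ((sspJ K - sspP K) *m w) a 0 = w s 0 - \sum_t sspP K a t * w t 0.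
Proof.
move=> sa; rewrite mulmxBl !mxE; congr (_ - _).
under eq_bigr do rewrite (sspJ_avail _ sa).
rewrite (bigD1 s) //= eqxx mul1r big1 ?addr0 // => t /negbTE->.
by rewrite mul0r.
Qed.

Lemma policy_P_ge0 Pi i j : 0 <= policy_P K Pi i j.
Proof. by case: hK => _ _ P0 _; rewrite mxE. Qed.

Lemma policy_P_le1 Pi i : \sum_j policy_P K Pi i j <= 1.
Proof. by case: hK => _ _ _ P1; under eq_bigr do rewrite mxE. Qed.

Lemma proper_policyP Pi : proper_policy K Pi <->
  (forall i, avail K i (Pi i)) /\ transient (policy_P K Pi).
Proof.
have H := transientP (policy_P_ge0 Pi) (policy_P_le1 Pi).
by rewrite /proper_policy; split=> -[? /H].
Qed.

(** Reduced costs are the slacks of the dual constraints at the policy value, so optimality of a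
    policy is dual feasibility of its value. *)
Lemma reduced_costE Pi a : reduced_cost K Pi 0 a =
  sspc K a 0 - ((sspJ K - sspP K) *m policy_value K Pi) a 0.
Proof.
rewrite /reduced_cost -!trmx_mul [LHS]mxE [X in X + _]mxE [X in _ + X]mxE.
by rewrite [X in _ - X]mxE.
Qed.

Lemma policy_value_bellman Pi : proper_policy K Pi ->
  (1%:M - policy_P K Pi) *m policy_value K Pi = policy_c K Pi.
Proof.
move=> /proper_policyP[_ Qt]; rewrite mulKVmx //.
exact: transient_unitmx (policy_P_ge0 Pi) (policy_P_le1 Pi) Qt.
Qed.

Lemma policy_rowE Pi (w : 'cV[R]_n) i : avail K i (Pi i) ->
  ((1%:M - policy_P K Pi) *m w) i 0 = ((sspJ K - sspP K) *m w) (Pi i) 0.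
Proof.
move=> av; rewrite oneB_mulmxE (JP_mulmxE _ av); congr (_ - _).
by apply: eq_bigr => j _; rewrite mxE.
Qed.

Lemma policy_valueE Pi i : proper_policy K Pi ->
  ((sspJ K - sspP K) *m policy_value K Pi) (Pi i) 0 = sspc K (Pi i) 0.
Proof.
move=> Pip; have /proper_policyP[av _] := Pip.
by rewrite -policy_rowE // policy_value_bellman // mxE.
Qed.

(** The value makes the constraints of the policy's own actions tight, so monotonicity bounds any
    other solution of these constraints. *)
Lemma policy_value_max Pi (d : 'cV[R]_n) : proper_policy K Pi ->
  (forall i, ((sspJ K - sspP K) *m d) (Pi i) 0 <= sspc K (Pi i) 0) ->
  forall i, d i 0 <= policy_value K Pi i 0.
Proof.
move=> Pip Hd i; have /proper_policyP[av Qt] := Pip.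
apply: (transient_le (policy_P_ge0 Pi) (policy_P_le1 Pi) Qt) => j.
by rewrite !policy_rowE // policy_valueE.
Qed.

Hypothesis c_ge0 : forall a, 0 <= sspc K a 0.

Lemma policy_value_ge0 Pi i : proper_policy K Pi -> 0 <= policy_value K Pi i 0.
Proof.
move=> Pip; have := @policy_value_max Pi 0 Pip _ i; rewrite mxE; apply => j.
by rewrite mulmx0 mxE.
Qed.

(** Common form of a Howard step and of a simplex pivot: any nonempty set of states may change to
    improving actions. *)
Definition improving_switch (Pi Pi' : {ffun 'I_n -> 'I_m}) : Prop :=
  (forall i, Pi' i = Pi i \/ improving K Pi i (Pi' i)) /\
  (exists i, improving K Pi i (Pi' i)).

Section Switch.
Variables Pi Pi' : {ffun 'I_n -> 'I_m}.
Hypothesis Pip : proper_policy K Pi.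
Hypothesis sw : improving_switch Pi Pi'.

Lemma improving_lt i : improving K Pi i (Pi' i) ->
  sspc K (Pi' i) 0 < ((sspJ K - sspP K) *m policy_value K Pi) (Pi' i) 0.
Proof. by case/andP => _; rewrite reduced_costE subr_lt0. Qed.

Lemma switch_avail i : avail K i (Pi' i).
Proof.
case: (sw.1 i) => [->|/andP[]//].
by have /proper_policyP[] := Pip.
Qed.

Lemma switch_le i :
  sspc K (Pi' i) 0 <= ((sspJ K - sspP K) *m policy_value K Pi) (Pi' i) 0.
Proof.
case: (sw.1 i) => [->|/improving_lt/ltW//].
by rewrite policy_valueE.
Qed.

(* Costs are nonnegative, so the old value is harmonic on a trap of the new
   policy; hence no action was switched there, and the trap is an old one. *)
Lemma switch_proper : proper_policy K Pi'.
Proof.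
apply/proper_policyP; split=> [i|C trC]; first exact: switch_avail.
have Q0 := policy_P_ge0 Pi'; have Q1 := policy_P_le1 Pi'.
have /proper_policyP[_ Qt] := Pip.
pose w i := policy_value K Pi i 0.
have rowE i : w i - \sum_j policy_P K Pi' i j * w j =
    ((sspJ K - sspP K) *m policy_value K Pi) (Pi' i) 0.
  by rewrite -oneB_mulmxE policy_rowE ?switch_avail.
have [||||D [trD Dw]] := superharmonic_trap Q0 Q1 (C := C) (w := w).
- exact: trC.1.
- by move=> i j; apply: trap_outside trC.
- by move=> i _; rewrite -subr_ge0 rowE (le_trans _ (switch_le i)).
- left=> i Ci; rewrite (bigID (mem C)) /= trC.2 // big1 ?addr0 // => j.
  exact: trap_outside trC Ci.
apply: (Qt D); split=> [|i Di]; first exact: trD.1.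
rewrite -(trD.2 _ Di); apply: eq_bigr => j _; rewrite !mxE.
case: (sw.1 i) => [->//|/improving_lt]; rewrite -rowE Dw // subrr.
by rewrite ltNge c_ge0.
Qed.

(** The old value satisfies the new policy's equations with [>=], hence dominates the new value.
    Equality would give a switched action zero slack, but its reduced cost was negative. *)
Lemma switch_value_lt :
  \sum_i policy_value K Pi' i 0 < \sum_i policy_value K Pi i 0.
Proof.
have Pip' := switch_proper; have /proper_policyP[_ Qt'] := Pip'.
have le i : policy_value K Pi' i 0 <= policy_value K Pi i 0.
  apply: (transient_le (policy_P_ge0 Pi') (policy_P_le1 Pi') Qt') => j.
  by rewrite !policy_rowE ?switch_avail // policy_valueE // switch_le.
rewrite lt_neqAle; apply/andP; split; last by apply: ler_sum => i _; apply: le.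
apply/eqP => E; have [i Hi] := sw.2.
have Ev := col_le_sum_eq le ltac:(by rewrite E).
by have := improving_lt Hi; rewrite -Ev policy_valueE // ltxx.
Qed.

End Switch.

Lemma howard_improving_switch Pi Pi' : ~ pi_optimal K Pi ->
  howard_switch K Pi Pi' -> improving_switch Pi Pi'.
Proof.
move=> nopt hsw; split=> [i|].
  by have := hsw i; case: ifP => _; [right|left].
apply: contrapT => none; apply: nopt => a; rewrite leNgt; apply/negP => neg.
have [s sa] := avail_ex a; apply: none; exists s; have := hsw s.
by have -> : [exists a, improving K Pi s a]
  by apply/existsP; exists a; apply/andP.
Qed.

Lemma howard_switch_ex Pi : exists Pi', howard_switch K Pi Pi'.
Proof.
exists [ffun i => odflt (Pi i) [pick a | improving K Pi i a]] => i.
rewrite ffunE; case: pickP => [a Ha|none] /=.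
  by rewrite ifT //; apply/existsP; exists a.
by rewrite ifF //; apply/existsP => -[a]; rewrite none.
Qed.

(** * Proper policies as simplex bases *)

Section Basis.
Variable Pi : {ffun 'I_n -> 'I_m}.
Hypothesis Pip : proper_policy K Pi.

Lemma basis_mx_policy : basis_mx K Pi = (1%:M - policy_P K Pi)^T.
Proof.
have /proper_policyP[av _] := Pip.
apply/matrixP => i j; rewrite !mxE (sspJ_avail _ (av j)); congr (_ - _).
by rewrite eq_sym.
Qed.

Lemma basis_unitmx : basis_mx K Pi \in unitmx.
Proof.
have /proper_policyP[_ Qt] := Pip; rewrite basis_mx_policy unitmx_tr.
exact: transient_unitmx (policy_P_ge0 Pi) (policy_P_le1 Pi) Qt.
Qed.

Lemma basis_mul (v : 'cV[R]_n) i : (basis_mx K Pi *m v) i 0 =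
  v i 0 - \sum_j policy_P K Pi j i * v j 0.
Proof.
rewrite basis_mx_policy linearB /= trmx1 mulmxBl mul1mx !mxE; congr (_ - _).
by apply: eq_bigr => j _; rewrite mxE.
Qed.

Lemma basic_val_ge0 i : 0 <= basic_val K Pi i 0.
Proof.
have /proper_policyP[_ Qt] := Pip.
rewrite /basic_val basis_mx_policy -trmx_inv mxE; apply: sumr_ge0 => j _.
rewrite !mxE mulr1.
exact: transient_invmx_ge0 (policy_P_ge0 Pi) (policy_P_le1 Pi) _ _ Qt.
Qed.

Lemma basic_val_eq i :
  basic_val K Pi i 0 - \sum_j policy_P K Pi j i * basic_val K Pi j 0 = 1.
Proof. by rewrite -basis_mul mulKVmx ?basis_unitmx // mxE. Qed.

(** Nondegeneracy: each state receives one unit from outside plus a nonnegative inflow, all carried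
    by its only basic action. *)
Lemma basic_val_gt0 i : 0 < basic_val K Pi i 0.
Proof.
apply: (@lt_le_trans _ _ 1) => //; rewrite -(basic_val_eq i) gerBl.
by apply: sumr_ge0 => j _; rewrite mulr_ge0 ?policy_P_ge0 ?basic_val_ge0.
Qed.

Lemma basic_sol_mul p (M : 'M[R]_(m, p)) :
  M^T *m basic_sol K Pi = (rowsub Pi M)^T *m basic_val K Pi.
Proof.
apply/matrixP => i j; rewrite ord1 !mxE.
under eq_bigr do rewrite !mxE mulr_sumr.
rewrite (exchange_big_dep predT) //=; apply: eq_bigr => k _.
by rewrite (big_pred1 (Pi k)) ?mxE // => a; rewrite eq_sym.
Qed.

Lemma basic_sol_feasible :
  (sspJ K - sspP K)^T *m basic_sol K Pi = const_mx 1.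
Proof. by rewrite basic_sol_mul mulKVmx ?basis_unitmx. Qed.

Lemma basic_sol_ge0 a : 0 <= basic_sol K Pi a 0.
Proof. by rewrite mxE sumr_ge0 // => i _; apply: basic_val_ge0. Qed.

(** Primal and dual objectives of a basis agree, both being [c_Pi] paired with the basic values. *)
Lemma basic_sol_cost :
  \sum_a sspc K a 0 * basic_sol K Pi a 0 = \sum_i policy_value K Pi i 0.
Proof.
have -> : \sum_a sspc K a 0 * basic_sol K Pi a 0 =
    ((sspc K)^T *m basic_sol K Pi) 0 0.
  by rewrite [RHS]mxE; apply: eq_bigr => a _; rewrite [_^T _ _]mxE.
rewrite basic_sol_mul -/(policy_c K Pi) -policy_value_bellman // trmx_mul.
rewrite -basis_mx_policy -mulmxA mulKVmx ?basis_unitmx // mxE.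
by apply: eq_bigr => i _; rewrite !mxE mulr1.
Qed.

Lemma pivot_mul q :
  basis_mx K Pi *m pivot_col K Pi q = (row q (sspJ K - sspP K))^T.
Proof. by rewrite mulKVmx ?basis_unitmx. Qed.

Lemma reduced_cost_pivot q : reduced_cost K Pi 0 q =
  sspc K q 0 - \sum_i sspc K (Pi i) 0 * pivot_col K Pi q i 0.
Proof.
rewrite reduced_costE; congr (_ - _).
have -> : \sum_i sspc K (Pi i) 0 * pivot_col K Pi q i 0 =
    ((policy_c K Pi)^T *m pivot_col K Pi q) 0 0.
  rewrite [RHS]mxE; apply: eq_bigr => a _.
  by rewrite [_^T _ _]mxE [X in _ = X * _]mxE.
rewrite -policy_value_bellman // trmx_mul -basis_mx_policy -mulmxA pivot_mul.
by rewrite -trmx_mul -row_mul !mxE.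
Qed.

(** With no positive pivot entry, nonnegative costs would make the reduced cost nonnegative: the
    ratio test never meets an unbounded ray. *)
Lemma leaving_ex q : reduced_cost K Pi 0 q < 0 -> exists r, leaving K Pi q r.
Proof.
rewrite reduced_cost_pivot subr_lt0 => lt.
have [i0 Hi0] : exists i, 0 < pivot_col K Pi q i 0.
  apply: contrapT => none; move: lt; rewrite ltNge => /negP; apply.
  apply: le_trans (c_ge0 q); apply: sumr_le0 => i _.
  apply: mulr_ge0_le0 => //; rewrite leNgt; apply/negP => H.
  by apply: none; exists i.
pose F i := basic_val K Pi i 0 / pivot_col K Pi q i 0.
case: (@arg_minP _ _ _ i0 (fun i => 0 < pivot_col K Pi q i 0) F Hi0) => r Hr rmin.
by exists r.
Qed.

(* The basic solution is positive and satisfies the flow equations with right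
   hand side 1, so a state cannot lose its only basic action. *)
Lemma leaving_avail q r : leaving K Pi q r -> avail K r q.
Proof.
move=> [ar rmin]; have [s sq] := avail_ex q.
have [<-//|sr] := eqVneq s r.
pose th := basic_val K Pi r 0 / pivot_col K Pi q r 0.
have th0 : 0 < th by rewrite divr_gt0 // basic_val_gt0.
(* Values of the old basic variables after [q] enters at level [th]; the one in position [r] drops
   to 0. *)
pose x := basic_val K Pi - th *: pivot_col K Pi q.
have xE i : x i 0 = basic_val K Pi i 0 - th * pivot_col K Pi q i 0.
  by rewrite !mxE.
have x0 i : 0 <= x i 0.
  rewrite xE subr_ge0; have [ai|ai] := ltP 0 (pivot_col K Pi q i 0).
    by rewrite -ler_pdivlMr //; apply: rmin.
  by apply: le_trans (basic_val_ge0 i); rewrite mulr_ge0_le0 // ltW.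
have xr : x r 0 = 0 by rewrite xE /th divfK ?subrr // gt_eqF.
have := basis_mul x r; rewrite xr.
(* If [q] lived in another state, the balance at [r] would equate minus an inflow with a number at
   least 1. *)
have -> : (basis_mx K Pi *m x) r 0 = 1 + th * sspP K q r.
  rewrite mulmxBr -scalemxAr pivot_mul mulKVmx ?basis_unitmx // !mxE.
  by rewrite (sspJ_avail _ sq) eq_sym (negbTE sr) sub0r mulrN opprK.
have : 0 <= \sum_j policy_P K Pi j r * x j 0.
  by apply: sumr_ge0 => j _; rewrite mulr_ge0 ?policy_P_ge0.
have : 0 <= th * sspP K q r.
  by case: hK => _ _ P0 _; rewrite mulr_ge0 // ltW.
by move=> H1 H2 H3; exfalso; lra.
Qed.

Lemma exchange_improving_switch q r : reduced_cost K Pi 0 q < 0 ->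
  leaving K Pi q r -> improving_switch Pi (exchange Pi q r).
Proof.
move=> neg /leaving_avail rq.
have imp : improving K Pi r (exchange Pi q r r).
  by rewrite ffunE eqxx; apply/andP.
split=> [i|]; last by exists r.
have [->|ir] := eqVneq i r; first by right.
by left; rewrite ffunE (negbTE ir).
Qed.

End Basis.
End PolicyIteration.

(** * The MAXPROB instance and duality between (RP) and (DRP) *)

Section PrimalDual.
Variables (R : realType) (n m : nat) (I : ssp R n m).
Hypothesis hI : is_ssp I.
Implicit Types y d : 'cV[R]_n.

Lemma maxprob_is_ssp y : is_ssp (maxprob I y).
Proof.
case: hI => J01 Juniq P0 P1; split=> /=.
- move=> a s; case: (split_ordP a) => k ->; rewrite ?col_mxEu ?col_mxEd mxE //.
  by case: eqP; [right|left].
- move=> a; case: (split_ordP a) => k ->.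
    have [s [Js uniq]] := Juniq (enum_val k); exists s.
    by split=> [|t]; rewrite col_mxEu mxE //; apply: uniq.
  exists k; split=> [|t]; rewrite col_mxEd mxE ?eqxx //.
  by case: eqP => [//|_] /eqP; rewrite eq_sym oner_eq0.
- by move=> a s; case: (split_ordP a) => k ->;
    rewrite ?col_mxEu ?col_mxEd mxE.
- move=> a; case: (split_ordP a) => k ->.
    by under eq_bigr do rewrite col_mxEu mxE.
  by under eq_bigr do rewrite col_mxEd mxE; rewrite big1.
Qed.

Lemma maxprob_c_tight y k : sspc (maxprob I y) (lshift n k) 0 = 0.
Proof. by rewrite /= col_mxEu mxE. Qed.

Lemma maxprob_c_artificial y i : sspc (maxprob I y) (rshift _ i) 0 = 1.
Proof. by rewrite /= col_mxEd mxE. Qed.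

Lemma maxprob_c_ge0 y a : 0 <= sspc (maxprob I y) a 0.
Proof.
by case: (split_ordP a) => k ->; rewrite ?maxprob_c_tight ?maxprob_c_artificial.
Qed.

Lemma maxprob_JP y :
  sspJ (maxprob I y) - sspP (maxprob I y) = col_mx (JP_restr I y) 1%:M.
Proof. by rewrite /= opp_col_mx add_col_mx subr0. Qed.

Lemma JP_restr_mul y d k :
  (JP_restr I y *m d) k 0 = ((sspJ I - sspP I) *m d) (enum_val k) 0.
Proof. by rewrite !mxE; apply: eq_bigr => j _; rewrite !mxE. Qed.

Lemma maxprob_mul_tight y d k :
  ((sspJ (maxprob I y) - sspP (maxprob I y)) *m d) (lshift n k) 0 =
  ((sspJ I - sspP I) *m d) (enum_val k) 0.
Proof. by rewrite maxprob_JP mul_col_mx col_mxEu JP_restr_mul. Qed.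

Lemma maxprob_mul_artificial y d i :
  ((sspJ (maxprob I y) - sspP (maxprob I y)) *m d) (rshift _ i) 0 = d i 0.
Proof. by rewrite maxprob_JP mul_col_mx col_mxEd mul1mx. Qed.

(** Without the enumeration of the tight set, feasibility visibly depends on [y] only through
    [tight I y]. *)
Lemma DRP_feasibleP y d : DRP_feasible I y d <->
  (forall a, a \in tight I y -> ((sspJ I - sspP I) *m d) a 0 <= 0) /\
  (forall i, d i 0 <= 1).
Proof.
split=> -[Ht Hd]; split=> // a; first move=> ta.
  by have := Ht (enum_rank_in ta a); rewrite JP_restr_mul enum_rankK_in.
by rewrite JP_restr_mul; apply: Ht; apply: enum_valP.
Qed.

(** (DRP) is the dual program of the MAXPROB instance: the bounds [d <= 1] are the constraints of
    the artificial actions. *)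
Lemma DRP_feasible_maxprob y d : DRP_feasible I y d <->
  (forall a, ((sspJ (maxprob I y) - sspP (maxprob I y)) *m d) a 0
     <= sspc (maxprob I y) a 0).
Proof.
split=> [[Ht Hd] a|H].
  case: (split_ordP a) => k ->.
    by rewrite maxprob_mul_tight -JP_restr_mul maxprob_c_tight.
  by rewrite maxprob_mul_artificial maxprob_c_artificial.
split=> [k|i].
  have := H (lshift n k).
  by rewrite maxprob_mul_tight -JP_restr_mul maxprob_c_tight.
by have := H (rshift _ i); rewrite maxprob_mul_artificial maxprob_c_artificial.
Qed.

(** Artificial actions lead straight to the target, so every subproblem has a starting policy. *)
Lemma artificial_proper y :
  proper_policy (maxprob I y) [ffun i => rshift #|tight I y| i].
Proof.
apply/(proper_policyP (maxprob_is_ssp y)); split=> [i|C [[i Ci] /(_ i Ci)/eqP]].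
  by rewrite /avail /= ffunE col_mxEd mxE eqxx.
rewrite big1 ?(eq_sym 0) ?oner_eq0 // => j _.
by rewrite mxE ffunE /= col_mxEd mxE.
Qed.

Lemma pi_optimal_DRP_feasible y (Pi : mp_policy I y) :
  pi_optimal (maxprob I y) Pi ->
  DRP_feasible I y (policy_value (maxprob I y) Pi).
Proof.
move=> opt; apply/DRP_feasible_maxprob => a.
by have := opt a; rewrite reduced_costE subr_ge0.
Qed.

Section OptimalPolicy.
Variables (y : 'cV[R]_n) (Pi : mp_policy I y).
Hypothesis Pip : proper_policy (maxprob I y) Pi.
Hypothesis Piopt : pi_optimal (maxprob I y) Pi.

Let v := policy_value (maxprob I y) Pi.

Lemma DRP_feasible_le_value d : DRP_feasible I y d -> forall i, d i 0 <= v i 0.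
Proof.
move=> /DRP_feasible_maxprob Hd.
by apply: (policy_value_max (maxprob_is_ssp y) Pip) => i.
Qed.

Lemma value_DRP_optimal : DRP_optimal I y v.
Proof.
split=> [|d Hd]; first exact: pi_optimal_DRP_feasible.
by apply: ler_sum => i _; apply: DRP_feasible_le_value.
Qed.

Lemma DRP_optimal_value d : DRP_optimal I y d -> d = v.
Proof.
move=> [Hd /(_ _ value_DRP_optimal.1)]; apply: col_le_sum_eq.
exact: DRP_feasible_le_value.
Qed.

Lemma RP_weak_duality (x : 'cV[R]_#|tight I y|) z d :
  RP_feasible x z -> DRP_feasible I y d ->
  \sum_i d i 0 <= \sum_i z i 0.
Proof.
move=> [E x0 z0] [Ht Hd].
(* Replacing the all-ones vector by the left side of the (RP) equation splits the sum into a
   nonpositive term in [x] and a term in [z] bounded through [d <= 1]. *)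
have -> : \sum_i d i 0 = (d^T *m ((JP_restr I y)^T *m x + z)) 0 0.
  by rewrite E mxE; apply: eq_bigr => i _; rewrite !mxE mulr1.
rewrite mulmxDr mulmxA -trmx_mul mxE -[leRHS]add0r lerD //.
  rewrite mxE; apply: sumr_le0 => k _; rewrite mxE; exact: mulr_le0_ge0.
rewrite mxE; apply: ler_sum => i _; rewrite mxE; exact: ler_piMl.
Qed.

Lemma mp_solution_value : \sum_i (mp_solution Pi).2 i 0 = \sum_i v i 0.
Proof.
rewrite -(basic_sol_cost (maxprob_is_ssp y) Pip) big_split_ord.
rewrite [X in _ = X + _]big1 ?add0r => [|k _]; last first.
  by rewrite maxprob_c_tight mul0r.
by apply: eq_bigr => i _; rewrite maxprob_c_artificial mul1r [LHS]mxE.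
Qed.

(** The final policy's value is feasible for (DRP) with the same objective, so weak duality
    certifies optimality and policy iteration never stops at a wrong solution. *)
Lemma mp_solution_RP_optimal :
  RP_optimal (mp_solution Pi).1 (mp_solution Pi).2.
Proof.
split=> [|x z Hxz]; last first.
  by rewrite mp_solution_value; apply: RP_weak_duality Hxz value_DRP_optimal.1.
have b0 := basic_sol_ge0 (maxprob_is_ssp y) Pip.
split=> [|a|i] /=; rewrite ?[usubmx _ _ _]mxE ?[dsubmx _ _ _]mxE //.
rewrite -(basic_sol_feasible (maxprob_is_ssp y) Pip) maxprob_JP.
by rewrite -{3}[basic_sol _ _]vsubmxK tr_col_mx mul_row_col trmx1 mul1mx.
Qed.

End OptimalPolicy.

(** * Termination of one subproblem *)

(** Matching on the source configuration avoids equalities between policies whose types depend on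
    [y]. *)
Lemma pd_step_inv meth (k k' : config I) : pd_step meth k k' ->
  match k with
  | Start y => exists2 Pi : mp_policy I y,
      proper_policy (maxprob I y) Pi & k' = Solve Pi
  | Solve y Pi =>
    [\/ exists2 Pi', meth = Howard /\ ~ pi_optimal (maxprob I y) Pi &
          howard_switch (maxprob I y) Pi Pi' /\ k' = Solve Pi',
        exists2 q, meth = Simple /\ reduced_cost (maxprob I y) Pi 0 q < 0 &
          k' = Pivot Pi q,
        pi_optimal (maxprob I y) Pi /\ k' = Done
      | pi_optimal (maxprob I y) Pi /\
        exists2 d, \sum_i (mp_solution Pi).2 i 0 <> 0 /\ DRP_optimal I y d &
          k' = Update I y d]
  | Pivot y Pi q => exists2 r, leaving (maxprob I y) Pi q r &
      k' = @Solve _ _ _ _ y (exchange Pi q r)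
  | Update y d => exists2 e, max_step I y d e & k' = Start (y + e *: d)
  | Done => False
  end.
Proof.
case.
- by move=> y Pi Pip; exists Pi.
- by move=> y Pi Pi' hm Pip nopt sw; apply: Or41; exists Pi'.
- by move=> y Pi q hm Pip neg; apply: Or42; exists q.
- by move=> y Pi q r lv; exists r.
- by move=> y Pi x z Pip opt _ _ _; apply: Or43.
- move=> y Pi x z d Pip opt E _ nz Hd; apply: Or44; split=> //; exists d => //.
  by rewrite E.
- by move=> y d e He; exists e.
Qed.

Lemma terminates_start meth y :
  (forall (Pi : mp_policy I y) d, proper_policy (maxprob I y) Pi ->
     pi_optimal (maxprob I y) Pi -> DRP_optimal I y d -> 0 < \sum_i d i 0 ->
     pd_terminates meth (Update I y d)) ->
  pd_terminates meth (Start y : config I).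
Proof.
move=> Hupd; pose K := maxprob I y.
have hK : is_ssp K := maxprob_is_ssp y.
have c0 : forall a, 0 <= sspc K a 0 := @maxprob_c_ge0 y.
suff Hsolve (Pi : mp_policy I y) :
    proper_policy K Pi -> pd_terminates meth (Solve Pi).
  apply: TermStep.
    by eexists; apply: StepStart; apply: artificial_proper.
  by move=> k' /pd_step_inv[Pi Pip ->]; apply: Hsolve.
(* The sum of the values strictly decreases along improving switches. *)
pose f (Pi : mp_policy I y) := \sum_i policy_value K Pi i 0.
move: Pi; apply: (fin_value_ind (f := f)) => Pi IH Pip.
have IHs Pi' : improving_switch K Pi Pi' ->
    pd_terminates meth (@Solve _ _ _ I y Pi').
  move=> sw; apply: IH; first exact (switch_value_lt hK c0 Pip sw).
  exact (switch_proper hK c0 Pip sw).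
apply: TermStep.
  have [opt|nopt] := pselect (pi_optimal K Pi).
    case E : (mp_solution Pi) => [x z].
    have RPo : RP_optimal x z.
      by have := mp_solution_RP_optimal Pip opt; rewrite E.
    have [z0|z0] := pselect (\sum_i z i 0 = 0).
      by exists Done; apply: StepStop E RPo z0.
    exists (Update I y (policy_value K Pi)).
    by apply: StepDirection E RPo z0 _ => //; apply: value_DRP_optimal.
  case: meth Hupd IH IHs => _ _ _.
    by have [Pi' sw] := howard_switch_ex K Pi; eexists; apply: StepHoward sw.
  have [q neg] : exists q, reduced_cost K Pi 0 q < 0.
    apply: contrapT => none; apply: nopt => a; rewrite leNgt; apply/negP => H.
    by apply: none; exists a.
  by exists (Pivot Pi q); apply: StepEnter.
move=> k' /pd_step_inv[].
- by move=> [Pi' [_ nopt] [sw ->]]; apply: IHs; apply: howard_improving_switch.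
- move=> [q [_ neg] ->]; apply: TermStep.
    have [r lv] := leaving_ex hK c0 Pip neg.
    by exists (@Solve _ _ _ I y (exchange Pi q r)); apply: StepLeave.
  move=> k'' /pd_step_inv[r lv ->]; apply: IHs.
  exact: exchange_improving_switch.
- by move=> [_ ->]; apply: TermDone.
- move=> [opt [d [z0 Hd] ->]]; apply: (Hupd Pi) => //.
  (* The (RP) optimum is nonzero and equals the sum of the nonnegative values, hence is positive. *)
  rewrite (DRP_optimal_value Pip opt Hd) lt_neqAle eq_sym.
  apply/andP; split; first by apply/eqP; rewrite -(mp_solution_value Pip).
  by apply: sumr_ge0 => i _; apply: policy_value_ge0.
Qed.

(** * The outer loop: step length and strict progress *)

(** Otherwise a positive maximum of [d] would propagate along support arcs and could never reach the
    target. *)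
Lemma reachable_ascent d : target_reachable I -> 0 < \sum_i d i 0 ->
  exists a, 0 < ((sspJ I - sspP I) *m d) a 0.
Proof.
move=> reach d0; apply: contrapT => none.
have Md a : ((sspJ I - sspP I) *m d) a 0 <= 0.
  by rewrite leNgt; apply/negP => H; apply: none; exists a.
have [i0 di0] : exists i, 0 < d i 0.
  apply: contrapT => H; move: d0; rewrite ltNge => /negP; apply.
  by apply: sumr_le0 => i _; rewrite leNgt; apply/negP => ?; apply: H; exists i.
case: (@arg_maxP _ _ _ i0 xpredT (fun i => d i 0) isT) => k _ kmax.
have dk0 : 0 < d k 0 by apply: lt_le_trans di0 (kmax _ _).
(* Invariant: maximizing states and the actions available there; it fails at the target. *)
pose Q (u : option 'I_n + option 'I_m) := match u with
  | inl (Some s) => d s 0 = d k 0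
  | inr (Some a) => exists2 s, avail I s a & d s 0 = d k 0
  | _ => False
  end.
suff closed u v : Q u -> support_arc I u v -> Q v.
  by have := connect_invariant closed (reach (Some k)); apply.
case: u => -[x|] //=; first by case: v => -[a|] //= dx xa; exists x.
move=> [s sx ds]; case: hI => _ _ P0 P1; have := Md x.
rewrite (JP_mulmxE hI _ sx) ds subr_le0 => le.
have tge0 t : 0 <= sspP I x t * (d k 0 - d t 0).
  by rewrite mulr_ge0 // subr_ge0; apply: kmax.
have E : \sum_t sspP I x t * (d k 0 - d t 0) =
    (\sum_t sspP I x t) * d k 0 - \sum_t sspP I x t * d t 0.
  by rewrite mulr_suml -sumrB; apply: eq_bigr => t _; rewrite mulrBr.
have S0 : 0 <= \sum_t sspP I x t * (d k 0 - d t 0) by apply: sumr_ge0.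
(* As [d k 0 > 0], the chain [d k 0 <= \sum_t P d <= (\sum_t P) * d k 0] leaves no probability of
   moving to the target. *)
have := P1 x => Px; have Px1 : \sum_t sspP I x t = 1.
  apply/eqP; rewrite eq_le Px -(ler_pM2r dk0) mul1r (le_trans le) //.
  by rewrite -subr_ge0 -E.
case: v => -[t|] //=; last by rewrite Px1 subrr ltxx.
have /psumr_eq0P H : \sum_t sspP I x t * (d k 0 - d t 0) = 0.
  by apply/eqP; rewrite eq_le S0 andbT E Px1 mul1r subr_le0.
move=> Pt; have /eqP := H (fun t _ => tge0 t) t isT.
by rewrite mulf_eq0 gt_eqF //= subr_eq0 => /eqP.
Qed.

Lemma max_step_blocking y d : target_reachable I -> D_feasible I y ->
  0 < \sum_i d i 0 ->
  (exists e, max_step I y d e) /\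
  (forall e, max_step I y d e -> exists2 a, a \in tight I (y + e *: d) &
     0 < ((sspJ I - sspP I) *m d) a 0).
Proof.
move=> reach fy d0; have [a0 Ha0] := reachable_ascent reach d0.
pose M := sspJ I - sspP I.
have ME e a : (M *m (y + e *: d)) a 0 = (M *m y) a 0 + e * (M *m d) a 0.
  by rewrite mulmxDr -scalemxAr mxE [X in _ + X]mxE.
(* Step length at which constraint [a] becomes tight; the least one over the ascending constraints
   is the maximal step. *)
pose F a := (sspc I a 0 - (M *m y) a 0) / (M *m d) a 0.
case: (@arg_minP _ _ _ a0 (fun a => 0 < (M *m d) a 0) F Ha0) => b Mb bmin.
have Fb0 : 0 <= F b by rewrite divr_ge0 ?subr_ge0 ?fy // ltW.
have fb : D_feasible I (y + F b *: d).
  move=> a; rewrite ME -lerBrDl; have [Ma|Ma] := ltP 0 ((M *m d) a 0).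
    by rewrite -ler_pdivlMr //; apply: bmin.
  by apply: (@le_trans _ _ 0); rewrite ?subr_ge0 ?fy // mulr_ge0_le0.
have bb e : D_feasible I (y + e *: d) -> e <= F b.
  by move=> /(_ b); rewrite ME -lerBrDl -ler_pdivlMr.
split=> [|e [e0 fe emax]]; first by exists (F b); split=> // e' _; apply: bb.
have -> : e = F b by apply/eqP; rewrite eq_le bb //= emax.
exists b => //; rewrite inE ME /F divfK; first by rewrite addrC subrK.
by rewrite gt_eqF.
Qed.

Lemma DRP_optimal_decrease y d e d' (Pi : mp_policy I y) :
  proper_policy (maxprob I y) Pi -> pi_optimal (maxprob I y) Pi ->
  DRP_optimal I y d ->
  (exists2 a, a \in tight I (y + e *: d) & 0 < ((sspJ I - sspP I) *m d) a 0) ->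
  DRP_optimal I (y + e *: d) d' -> \sum_i d' i 0 < \sum_i d i 0.
Proof.
move=> Pip opt dopt [a ta Ma] [/DRP_feasibleP[Ht Hd] _].
have dv := DRP_optimal_value Pip opt dopt.
have hK := maxprob_is_ssp y.
have le i : d' i 0 <= d i 0.
  (* [d'] obeys the constraints of [Pi]: the artificial ones are [d' <= 1], and its tight actions
     stay tight because [(J - P) d] vanishes on them. *)
  rewrite {}dv in ta Ht Ma *; apply: (policy_value_max hK Pip) => j.
  have := policy_valueE hK j Pip.
  case: (split_ordP (Pi j)) => k ->; last first.
    by rewrite !maxprob_mul_artificial maxprob_c_artificial.
  rewrite !maxprob_mul_tight maxprob_c_tight => Mk; apply: Ht.
  have := enum_valP k; rewrite !inE mulmxDr -scalemxAr => /eqP tk.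
  by rewrite mxE [X in _ + X]mxE Mk mulr0 addr0 tk.
rewrite lt_neqAle; apply/andP; split; last by apply: ler_sum.
apply/eqP => E; have ddE := col_le_sum_eq le ltac:(by rewrite E).
by have := Ht _ ta; rewrite ddE leNgt Ma.
Qed.

(** Indexed by the set rather than by [y], so that induction runs over a finite type; 0 is the
    default for sets that do not arise with a (DRP) optimum. *)
Definition DRP_value (A : {set 'I_m}) : R :=
  xget 0 [set r | exists y d,
    [/\ tight I y = A, DRP_optimal I y d & r = \sum_i d i 0]]%classic.

(** Equal tight sets give equal feasible regions, so all optima for one set share their objective
    value. *)
Lemma DRP_valueE y d : DRP_optimal I y d ->
  DRP_value (tight I y) = \sum_i d i 0.
Proof.
move=> dopt; apply: xget_unique => /=; first by exists y, d.
move=> _ [y' [d' [E [fd' max'] ->]]].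
have sub d1 : DRP_feasible I y d1 <-> DRP_feasible I y' d1.
  by rewrite !DRP_feasibleP E.
apply/eqP; rewrite eq_le dopt.2 /=; last exact/sub.
by rewrite max' //; apply/sub; case: dopt.
Qed.

Lemma terminates_update meth y d (Pi : mp_policy I y) :
  target_reachable I -> D_feasible I y ->
  proper_policy (maxprob I y) Pi -> pi_optimal (maxprob I y) Pi ->
  DRP_optimal I y d -> 0 < \sum_i d i 0 ->
  pd_terminates meth (Update I y d).
Proof.
(* The tight set becomes the induction variable; [y], [d] and [Pi] stay general, as they change at
   each update. *)
move=> reach; have [A] : {A | tight I y = A} by exists (tight I y).
move: A y d Pi; apply: (fin_value_ind (f := DRP_value)).
move=> A IH y d Pi EA fy Pip opt dopt d0.
have [[e He] blk] := max_step_blocking reach fy d0.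
apply: TermStep; first by exists (Start (y + e *: d)); apply: StepUpdate.
move=> k' /pd_step_inv[{He}e He ->]; have := blk _ He => blke.
apply: terminates_start => Pi' d' Pip' opt' dopt' d'0.
apply: (IH _ _ _ _ Pi' erefl) => //; last by case: He.
rewrite -EA (DRP_valueE dopt) (DRP_valueE dopt').
exact: DRP_optimal_decrease Pip opt dopt blke dopt'.
Qed.

End PrimalDual.

Theorem theorem5 (R : realType) (n m : nat) (I : ssp R n m)
    (hI : is_ssp I)
    (hc : forall a, 0 <= sspc I a 0)
    (hreach : target_reachable I) :
  D_feasible I 0 /\
  forall meth : pi_method, pd_terminates meth (Start 0 : config I).
Proof.
have f0 : D_feasible I 0 by move=> a; rewrite mulmx0 mxE.
split=> // meth; apply: terminates_start => // Pi d Pip opt dopt d0.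
by apply: (terminates_update hI) opt dopt d0.
Qed.
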